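(* Let $(G,\tau)$ and $(H,\sigma)$ be topological groups and $f:(G,\tau)\to(H,\sigma)$ a continuous surjective homomorphism. If $f$ is strongly A$^*$-open, then $f$ is semitopological.
   Context: Topological groups are not assumed Hausdorff. $\mathcal V_{(G,\tau)}(e_G)$ is the filter of all neighborhoods of $e_G$ in $(G,\tau)$. For a neighborhood $U$ of $e_G$, a subset $M\subseteq G$ is $U$-thin if $\bigcap\{x^{-1}Ux:x\in M\}$ is a neighborhood of $e_G$. Write $[x,y]=xyx^{-1}y^{-1}$ and, for $g\in G$ and $K\subseteq G$, $[g,K]=\{[g,k]:k\in K\}$. A section of a surjective homomorphism $f:G\to H$ is an injective function $s:H\to G$ such that $f(s(h))=h$ for every $h\in H$ and $s(e_H)=e_G$ (no continuity required). A map $t:H\to G$ between topological groups is a quasihomomorphism if $t(e_H)=e_G$, the map $t':H\times H\to G$, $t'(h_1,h_2)=t(h_1)t(h_2)t(h_1h_2)^{-1}$, is continuous at $(e_H,e_H)$, and for every $y\in H$ the map $t_y:H\to G$, $t_y(h)=t(y)t(h)t(y)^{-1}t(yhy^{-1})^{-1}$, is continuous at $e_H$. A surjective homomorphism $f:(G,\tau)\to(H,\sigma)$ is strongly A$^*$-open if there exists a section $s$ of $f$ which is a quasihomomorphism and such that for every $U\in\mathcal V_{(G,\tau)}(e_G)$: (a) there exists $V\in\mathcal V_{(H,\sigma)}(e_H)$ such that $s(V)$ is $U$-thin; (b) for every $g\in G$ there exists $V_g\in\mathcal V_{(H,\sigma)}(e_H)$ such that $[g,s(V_g)]\subseteq U$.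 A continuous surjective homomorphism $f:(G,\tau)\to(H,\sigma)$ is semitopological if there exist a topological group $(\widetilde G,\widetilde\tau)$ containing $G$ as a topological normal subgroup (i.e. $G$ is, up to identification via a topological isomorphism onto its image, a normal subgroup of $\widetilde G$ and $\widetilde\tau\restriction_G=\tau$) and an open continuous homomorphism $\widetilde f:(\widetilde G,\widetilde\tau)\to(H,\sigma)$ extending $f$. *)

(* Defs.v *)
From HB Require Import structures.
From mathcomp Require Import all_boot.
From mathcomp Require Import all_classical.
From mathcomp Require Import topology.

Set Implicit Arguments.
Unset Strict Implicit.
Unset Printing Implicit Defensive.

Local Open Scope classical_set_scope.
Local Open Scope group_scope.

(* Multiplicative analogue of MathComp-Analysis' [topologicalZmodType]; no
   separation axiom is assumed. *)
HB.mixin Record isTopologicalGroup G & Topological G & Group G := {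
  mulg_continuous : continuous (fun p : G * G => p.1 * p.2);
  invg_continuous : continuous (fun x : G => x^-1)
}.

#[short(type="topologicalGroupType")]
HB.structure Definition TopologicalGroup :=
  {G of Topological G & Group G & isTopologicalGroup G}.

(* [x, y] = x y x^-1 y^-1; MathComp's [~ x, y] is x^-1 y^-1 x y instead. *)
Definition comm (G : groupType) (x y : G) : G := x * y * x^-1 * y^-1.

Definition normal_subgroup (G : groupType) (N : set G) : Prop :=
  [/\ N 1,
      forall x y, N x -> N y -> N (x * y^-1)
    & forall g x, N x -> N (g * x * g^-1)].

Definition open_map (S T : topologicalType) (f : S -> T) : Prop :=
  forall A : set S, open A -> open (f @` A).

(* The topology of S is the one induced from T through the injection i. *)
Definition topological_embedding (S T : topologicalType) (i : S -> T) : Prop :=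
  injective i /\
  forall A : set S, open A <-> exists2 B : set T, open B & A = i @^-1` B.

(* The notion is meant for U a neighborhood of 1. *)
Definition thin (G : topologicalGroupType) (U M : set G) : Prop :=
  nbhs (1 : G) (\bigcap_(x in M) [set x^-1 * u * x | u in U]).

Definition is_section (G H : groupType) (f : G -> H) (s : H -> G) : Prop :=
  [/\ injective s, forall h, f (s h) = h & s 1 = 1].

Definition quasihomomorphism (H G : topologicalGroupType) (t : H -> G) : Prop :=
  [/\ t 1 = 1,
      continuous_at ((1, 1) : H * H)
        (fun p : H * H => t p.1 * t p.2 * (t (p.1 * p.2))^-1)
    & forall y : H,
        continuous_at (1 : H)
          (fun h : H => t y * t h * (t y)^-1 * (t (y * h * y^-1))^-1)].

Definition strongly_Astar_open (G H : topologicalGroupType) (f : G -> H)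
    : Prop :=
  exists s : H -> G,
    [/\ is_section f s,
        quasihomomorphism s
      & forall U : set G, nbhs (1 : G) U ->
          (exists2 V : set H, nbhs (1 : H) V & thin U (s @` V)) /\
          (forall g : G, exists2 V : set H,
             nbhs (1 : H) V & [set comm g k | k in s @` V] `<=` U)].

(* G is identified with its image under the embedding i. *)
Definition semitopological (G H : topologicalGroupType) (f : G -> H) : Prop :=
  exists (Gt : topologicalGroupType) (i : {multiplicative G -> Gt})
         (ft : {multiplicative Gt -> H}),
    [/\ topological_embedding i,
        normal_subgroup (range i),
        continuous ft,
        open_map ft
      & forall g : G, ft (i g) = f g].

(* Main.v *)
Require Import Defs.
From HB Require Import structures.
From mathcomp Require Import all_boot.
From mathcomp Require Import all_classical.
From mathcomp Require Import topology.

Local Open Scope classical_set_scope.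

(** The extension is the direct product [G * H], with [G] embedded as the first
    factor and [f] extended by [(g, h) |-> f g]; only its topology is subtle.
    Let [s] be a section witnessing strong A*-openness. Around the identity,
    the pairs [(u * s h, h)] with [u] near [1] in [G] and [h] near [1] in [H]
    are declared to be small.

    On the slice [h = 1] this gives back the topology of [G], because
    [s 1 = 1]. The extension sends [(u * s h, h)] to [f u * h]: this is small,
    whence continuity, and taking [u = 1] yields all small [h], whence openness.

    What remains is that the filter of sets of small elements is the
    neighbourhood filter of the identity for a group topology
    ([group_topology]). Each of the three operations, read in the coordinates
    [(u, h)], has to converge to the identity, and each hypothesis on [s] serves
    there:
    - product: the first coordinate is
      [u * (s h * u' * (s h)^-1) * (s h * s h' * (s (h * h'))^-1)], small by
      thinness and by the first quasihomomorphism condition;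
    - inverse: likewise, as [(s h)^-1] differs from [s h^-1] by the inverse of
      [s h^-1 * s h];
    - conjugation by [(g, k)]: the first coordinate is a product of conjugates
      of [u] and [s k * s h * (s k)^-1 * (s (k * h * k^-1))^-1] by fixed
      elements, and of the commutator of [g * (s k)^-1] and
      [s (k * h * k^-1)]. The second quasihomomorphism condition and the
      commutator condition make it small. *)

Set Implicit Arguments.
Unset Strict Implicit.
Unset Printing Implicit Defensive.

Local Open Scope group_scope.

(** * Limits in topological groups *)

Section GroupLimits.
Context {G : topologicalGroupType} {T : Type}.
Context {F : set_system T} {FF : Filter F}.
Implicit Types (u v : T -> G) (a b : G).

Lemma cvg_mulg u v a b :
  u x @[x --> F] --> a -> v x @[x --> F] --> b ->
  u x * v x @[x --> F] --> a * b.
Proof.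
apply: (@continuous2_cvg T G G G F FF u v (fun x y : G => x * y)).
exact: (mulg_continuous (a, b)).
Qed.

Lemma cvg_mul1g u v :
  u x @[x --> F] --> (1 : G) -> v x @[x --> F] --> (1 : G) ->
  u x * v x @[x --> F] --> (1 : G).
Proof. by move=> u1 v1; rewrite -[1 in X in _ --> X]mulg1; exact: cvg_mulg. Qed.

Lemma cvg_invg u a : u x @[x --> F] --> a -> (u x)^-1 @[x --> F] --> a^-1.
Proof. by apply: continuous_cvg; exact: (invg_continuous a). Qed.

Lemma cvg_inv1g u :
  u x @[x --> F] --> (1 : G) -> (u x)^-1 @[x --> F] --> (1 : G).
Proof. by move=> u1; rewrite -[1 in X in _ --> X]invg1; exact: cvg_invg. Qed.

Lemma cvg_conj1 g u : u x @[x --> F] --> (1 : G) ->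
  g * u x * g^-1 @[x --> F] --> (1 : G).
Proof.
move=> u1; have -> : 1 = g * 1 * g^-1 by rewrite mulg1 mulgV.
by apply: cvg_mulg; [apply: cvg_mulg => //|]; exact: cvg_cst.
Qed.

End GroupLimits.

Lemma nbhs_translate (G : topologicalGroupType) (x : G) (A : set G) :
  nbhs x A <-> nbhs (1 : G) [set y | A (x * y)].
Proof.
split => [xA|].
  have : x * y @[y --> (1 : G)] --> x * 1.
    by apply: cvg_mulg; [exact: cvg_cst|exact: cvg_id].
  by rewrite mulg1; apply.
move=> xA.
have : x^-1 * y @[y --> x] --> x^-1 * x.
  by apply: cvg_mulg; [exact: cvg_cst|exact: cvg_id].
rewrite mulVg => /(_ _ xA); apply: (filterS (F := nbhs x)) => y /=.
by rewrite mulgA mulgV mul1g.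
Qed.

(** * Group topologies from a filter at the identity *)

(** The classical axioms for the neighbourhood filter of the identity. *)
Record group_filter (E : groupType) (F : set_system E) : Prop := GroupFilter {
  group_filter_filter : Filter F;
  group_filter_one : forall A, F A -> A 1;
  group_filter_mul : forall A, F A ->
    exists2 B, F B & forall x y, B x -> B y -> A (x * y);
  group_filter_inv : forall A, F A -> F [set x | A x^-1];
  group_filter_conj : forall g A, F A -> F [set x | A (g * x * g^-1)]
}.

(** A copy of [E] whose type records the filter, so that the topology built from
    it can be attached to the type even if [E] has another topology. *)
Definition group_topology (E : groupType) (F : set_system E)
  of group_filter F : Type := E.

Section GroupTopology.
Context {E : groupType} {F : set_system E} (FP : group_filter F).

Let FF : Filter F := group_filter_filter FP.
#[local] Existing Instance FF.

HB.instance Definition _ := Group.on (group_topology FP).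

Let T := group_topology FP.

Let translates (x : T) : set_system T := [set A | F [set y | A (x * y)]].

HB.instance Definition _ := hasNbhs.Build (group_topology FP) translates.

Lemma group_topology_nbhsE (x : T) (A : set T) :
  nbhs x A = F [set y | A (x * y)].
Proof. by []. Qed.

Let translates_filter (x : T) : ProperFilter (nbhs x).
Proof.
split; first by move=> /(group_filter_one FP).
split; rewrite /nbhs/=.
- exact: filterT.
- by move=> A B xA xB; exact: filterI xA xB.
- by move=> A B AB; apply: filterS => y /=; exact: AB.
Qed.

Let translates_singleton (x : T) (A : set T) : nbhs x A -> A x.
Proof. by move=> /(group_filter_one FP)/=; rewrite mulg1. Qed.

Let translates_nbhs (x : T) (A : set T) : nbhs x A -> nbhs x (nbhs^~ A).
Proof.
move=> /(group_filter_mul FP)[B FB BA]; rewrite group_topology_nbhsE.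
apply: filterS (FB) => y By /=; rewrite group_topology_nbhsE.
by apply: filterS FB => z Bz /=; rewrite -mulgA; exact: BA.
Qed.

HB.instance Definition _ := Nbhs_isNbhsTopological.Build (group_topology FP)
  translates_filter translates_singleton translates_nbhs.

Let mulT_continuous : continuous (fun p : T * T => p.1 * p.2).
Proof.
move=> [a b] A /(group_filter_mul FP)[B FB BA].
exists ([set x | B (b^-1 * (a^-1 * x) * b)], [set y | B (b^-1 * y)]).
  split; rewrite /= group_topology_nbhsE.
    have := group_filter_conj FP b^-1 FB.
    by apply: filterS => x /=; rewrite invgK mulKg.
  by apply: filterS FB => y /=; rewrite mulKg.
move=> [x y] [/= Bx By].
have := BA _ _ Bx By.
by rewrite /= !mulgA mulgK -!mulgA !mulVKg.
Qed.

Let invT_continuous : continuous (fun x : T => x^-1).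
Proof.
move=> a A aA; have := group_filter_inv FP (group_filter_conj FP a aA).
by apply: (filterS (F := F)) => x /=; rewrite invgM -!mulgA mulKg.
Qed.

HB.instance Definition _ := isTopologicalGroup.Build (group_topology FP)
  mulT_continuous invT_continuous.

End GroupTopology.

(** * The twisted product topology *)

Section TwistedProduct.
Context {G H : topologicalGroupType} (s : H -> G).

Definition twist (p : G * H) : G * H := (p.1 * s p.2, p.2).

Definition twisted_filter : set_system (G * H) :=
  twist p @[p --> ((1, 1) : G * H)].

Hypothesis s1 : s 1 = 1.

Hypothesis s_mul :
  s p.1 * s p.2 * (s (p.1 * p.2))^-1 @[p --> ((1, 1) : H * H)] --> (1 : G).

Hypothesis s_conj : forall k : H,
  s k * s h * (s k)^-1 * (s (k * h * k^-1))^-1 @[h --> (1 : H)] --> (1 : G).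

Hypothesis s_thin :
  s p.2 * p.1 * (s p.2)^-1 @[p --> ((1, 1) : G * H)] --> (1 : G).

Hypothesis s_comm : forall g : G, comm g (s h) @[h --> (1 : H)] --> (1 : G).

Local Notation N := (nbhs ((1, 1) : G * H)).

Let fstN : p.1 @[p --> N] --> (1 : G). Proof. exact: cvg_fst. Qed.
Let sndN : p.2 @[p --> N] --> (1 : H). Proof. exact: cvg_snd. Qed.

Let twisted_one A : twisted_filter A -> A 1.
Proof. by move=> /nbhs_singleton; rewrite /twist/= s1 mulg1. Qed.

(** The maps [m], [j] and [c] below are the group operations read through the
    bijection [twist]. Their first coordinates, found by dividing out the value
    of [s] at the second one, are arranged as products of factors that each
    tend to [1] by one hypothesis on [s]. *)
Let twisted_mul A : twisted_filter A ->
  exists2 B, twisted_filter B & forall x y, B x -> B y -> A (x * y).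
Proof.
move=> FA.
pose m (q : (G * H) * (G * H)) : G * H :=
  (q.1.1 * (s q.1.2 * q.2.1 * (s q.1.2)^-1)
     * (s q.1.2 * s q.2.2 * (s (q.1.2 * q.2.2))^-1), q.1.2 * q.2.2).
have mE x y : twist x * twist y = twist (m (x, y)).
  by congr pair; rewrite /m /= -!mulgA mulVg mulg1 mulKg.
have m1 : m q @[q --> (N, N)] --> ((1, 1) : G * H).
  have c1 : q.1 @[q --> (N, N)] --> ((1, 1) : G * H) by exact: cvg_fst.
  have c2 : q.2 @[q --> (N, N)] --> ((1, 1) : G * H) by exact: cvg_snd.
  have c11 : q.1.1 @[q --> (N, N)] --> (1 : G) := cvg_comp _ _ c1 fstN.
  have c12 : q.1.2 @[q --> (N, N)] --> (1 : H) := cvg_comp _ _ c1 sndN.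
  have c21 : q.2.1 @[q --> (N, N)] --> (1 : G) := cvg_comp _ _ c2 fstN.
  have c22 : q.2.2 @[q --> (N, N)] --> (1 : H) := cvg_comp _ _ c2 sndN.
  apply: cvg_pair; last exact: cvg_mul1g.
  apply: cvg_mul1g; last first.
    exact: (cvg_comp _ _ (cvg_pair c12 c22) s_mul).
  apply: cvg_mul1g => //.
  exact: (cvg_comp _ _ (cvg_pair c21 c12) s_thin).
have [[P Q] [/= NP NQ] PQ] := m1 _ FA.
exists (twist @` (P `&` Q)).
  have : N (P `&` Q) by apply: filterI.
  by apply: (filterS (F := N)); exact: preimage_image.
move=> _ _ [x [Px _] <-] [y [_ Qy] <-]; rewrite mE.
exact: (PQ (x, y)).
Qed.

Let twisted_inv A : twisted_filter A -> twisted_filter [set x | A x^-1].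
Proof.
pose j (p : G * H) : G * H :=
  ((s p.2^-1 * s p.2)^-1 * (s p.2^-1 * p.1^-1 * (s p.2^-1)^-1), p.2^-1).
have jE x : (twist x)^-1 = twist (j x).
  by congr pair; rewrite /j /= !invgM -!mulgA mulVg mulg1 mulKg.
have j1 : j p @[p --> N] --> ((1, 1) : G * H).
  have sndV : p.2^-1 @[p --> N] --> (1 : H) by exact: cvg_inv1g.
  have fstV : p.1^-1 @[p --> N] --> (1 : G) by exact: cvg_inv1g.
  apply: cvg_pair => //; apply: cvg_mul1g.
    apply: cvg_inv1g.
    have -> : (fun p : G * H => s p.2^-1 * s p.2) =
        (fun p => s p.1 * s p.2 * (s (p.1 * p.2))^-1) \o
        (fun p => (p.2^-1, p.2)).
      by apply/funext => p /=; rewrite mulVg s1 invg1 mulg1.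
    exact: (cvg_comp _ _ (cvg_pair sndV sndN) s_mul).
  exact: (cvg_comp _ _ (cvg_pair fstV sndV) s_thin).
by move=> /j1; apply: (filterS (F := N)) => x; rewrite /= jE.
Qed.

Let twisted_conj g A :
  twisted_filter A -> twisted_filter [set x | A (g * x * g^-1)].
Proof.
case: g => g k.
pose c (p : G * H) : G * H :=
  let h' := k * p.2 * k^-1 in let g' := g * (s k)^-1 in
  (g * p.1 * g^-1 * (g' * (s k * s p.2 * (s k)^-1 * (s h')^-1) * g'^-1)
     * comm g' (s h'), h').
have cE x : (g, k) * twist x * (g, k)^-1 = twist (c x).
  congr pair; rewrite /c /comm /= !invgM !invgK -!mulgA.
  by rewrite ?(mulKg, mulVKg) mulVg mulg1.
have c1 : c p @[p --> N] --> ((1, 1) : G * H).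
  have conjN : k * p.2 * k^-1 @[p --> N] --> (1 : H) by exact: cvg_conj1.
  apply: cvg_pair => //; apply: cvg_mul1g.
    apply: cvg_mul1g; first exact: cvg_conj1.
    by apply: cvg_conj1; exact: (cvg_comp _ _ sndN (s_conj k)).
  exact: (cvg_comp _ _ conjN (s_comm _)).
by move=> /c1; apply: (filterS (F := N)) => x; rewrite /= cE.
Qed.

Lemma twisted_group_filter : group_filter twisted_filter.
Proof. by split => //; exact: fmap_filter. Qed.

End TwistedProduct.

(** * The extension *)

Section Extension.
Context {G H : topologicalGroupType} {s : H -> G} (s1 : s 1 = 1).
Context (FP : group_filter (twisted_filter s)).

Let Gt := group_topology FP.

Definition slice_embedding (g : G) : Gt := (g, 1).

Let slice_embeddingM : {morph slice_embedding : x y / x * y}.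
Proof. by move=> x y; congr pair; rewrite mulg1. Qed.

HB.instance Definition _ := isMultiplicative.Build G Gt slice_embedding
  slice_embeddingM.

Lemma nbhs_twistedE (x : Gt) (A : set Gt) :
  nbhs x A = \forall p \near ((1, 1) : G * H), A (x * twist s p).
Proof. by []. Qed.

Lemma slice_embedding_continuous : continuous slice_embedding.
Proof.
move=> g A; rewrite nbhs_twistedE => gA; apply/nbhs_translate.
have : (u, 1) @[u --> (1 : G)] --> ((1, 1) : G * H).
  by apply: cvg_pair; [exact: cvg_id|exact: cvg_cst].
move=> /(_ _ gA); apply: (filterS (F := nbhs (1 : G))) => u /=.
rewrite /twist /= s1 mulg1 /slice_embedding.
by congr A; congr pair; rewrite mulg1.
Qed.

(** On the slice [h = 1] the twist is trivial, so a twisted neighbourhood of the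
    identity meets it in an ordinary neighbourhood of the identity of [G]. *)
Lemma slice_embedding_embedding : topological_embedding slice_embedding.
Proof.
split=> [x y [//]|A]; split=> [Aop|[B Bop ->]]; last first.
  by apply: open_comp => // x _; exact: slice_embedding_continuous.
(* The pairs off the slice impose nothing, so this is the largest open set with
   trace contained in [A]. *)
exists (interior [set x : Gt | x.2 = 1 -> A x.1]); first exact: open_interior.
apply/seteqP; split => g; last by move=> /interior_subset; exact.
move=> Ag; rewrite /interior /= nbhs_twistedE.
have /nbhs_translate gA := open_nbhs_nbhs (conj Aop Ag).
have : p.1 @[p --> ((1, 1) : G * H)] --> (1 : G) by exact: cvg_fst.
move=> /(_ _ gA); apply: (filterS (F := nbhs ((1, 1) : G * H))).
by move=> -[u h] /= Agu; rewrite mul1g => ->; rewrite s1 mulg1.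
Qed.

Lemma slice_embedding_normal : normal_subgroup (range slice_embedding).
Proof.
split.
- by exists 1.
- move=> _ _ [x _ <-] [y _ <-]; exists (x * y^-1) => //.
  by congr pair; rewrite mulgV.
- move=> [g k] _ [x _ <-]; exists (g * x * g^-1) => //.
  by congr pair; rewrite /= mulg1 mulgV.
Qed.

Context (f : {multiplicative G -> H}).

Definition fst_extension (x : Gt) : H := f x.1.

Let fst_extensionM : {morph fst_extension : x y / x * y}.
Proof. by move=> x y; exact: gmulfM. Qed.

HB.instance Definition _ := isMultiplicative.Build Gt H fst_extension
  fst_extensionM.

Hypothesis fs : forall h, f (s h) = h.

Lemma fst_extension_twist (x : Gt) (p : G * H) :
  fst_extension (x * twist s p) = fst_extension x * (f p.1 * p.2).
Proof. by rewrite /fst_extension /= !gmulfM fs. Qed.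

Let f1 : f 1 = 1. Proof. by rewrite -s1 fs. Qed.

Lemma fst_extension_continuous : continuous f -> continuous fst_extension.
Proof.
move=> fC x A /nbhs_translate xA.
have : f p.1 * p.2 @[p --> ((1, 1) : G * H)] --> (1 : H).
  apply: cvg_mul1g.
    have : f u @[u --> (1 : G)] --> (1 : H).
      by rewrite -[X in _ --> X]f1; exact: fC.
    by apply: cvg_comp; exact: cvg_fst.
  exact: cvg_snd.
move=> /(_ _ xA); apply: (filterS (F := nbhs ((1, 1) : G * H))) => p.
by rewrite /= fst_extension_twist.
Qed.

(** Moving [x] by the small elements [(s h, h)] moves its image by every small
    [h]. *)
Lemma fst_extension_open : open_map fst_extension.
Proof.
move=> A Aop; rewrite openE => _ [x Ax <-]; apply/nbhs_translate.
have : nbhs x A by exact: open_nbhs_nbhs.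
rewrite nbhs_twistedE => xA.
have : (1, h) @[h --> (1 : H)] --> ((1, 1) : G * H).
  by apply: cvg_pair; [exact: cvg_cst|exact: cvg_id].
move=> /(_ _ xA); apply: (filterS (F := nbhs (1 : H))) => h /= Ah.
exists (x * twist s (1, h)) => //.
by rewrite fst_extension_twist /= f1 mul1g.
Qed.

Lemma semitopological_twisted : continuous f -> semitopological f.
Proof.
move=> fC; exists Gt, slice_embedding, fst_extension; split.
- exact: slice_embedding_embedding.
- exact: slice_embedding_normal.
- exact: fst_extension_continuous.
- exact: fst_extension_open.
- by [].
Qed.

End Extension.

(** * Strong A*-openness as convergence *)

(** Thinness is uniform smallness of the conjugates of a small [u] by the values
    of [s], that is, joint convergence in [u] and [h]. *)
Lemma thin_cvg (G H : topologicalGroupType) (s : H -> G) :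
  (forall U : set G, nbhs (1 : G) U ->
    exists2 V : set H, nbhs (1 : H) V & thin U (s @` V)) ->
  s p.2 * p.1 * (s p.2)^-1 @[p --> ((1, 1) : G * H)] --> (1 : G).
Proof.
move=> s_thin U /s_thin[V NV thinV].
exists (\bigcap_(x in s @` V) [set x^-1 * u * x | u in U], V) => //.
move=> [w h] [/= Uw Vh].
have [|u Uu <-] := Uw (s h); first by exists h.
by rewrite !mulgA mulgV mul1g mulgK.
Qed.

Lemma comm_cvg (G H : topologicalGroupType) (s : H -> G) (g : G) :
  (forall U : set G, nbhs (1 : G) U -> exists2 V : set H,
     nbhs (1 : H) V & [set comm g k | k in s @` V] `<=` U) ->
  comm g (s h) @[h --> (1 : H)] --> (1 : G).
Proof.
move=> s_comm U /s_comm[V NV VU]; apply: filterS NV => h Vh.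
by apply: VU; exists (s h) => //; exists h.
Qed.

Theorem corollary4p21 (G H : topologicalGroupType)
    (f : {multiplicative G -> H})
    (f_continuous : continuous f)
    (f_surjective : set_surj [set: G] [set: H] f)
    (f_Astar_open : strongly_Astar_open f) :
  semitopological f.
Proof.
have [s [[_ fs s1] [_ s_mul s_conj] sU]] := f_Astar_open.
apply: (semitopological_twisted s1 _ fs) => //.
apply: twisted_group_filter => //.
- by move: s_mul; rewrite /continuous_at /= mulg1 !s1 invg1 !mulg1.
- move=> k; move: (s_conj k).
  by rewrite /continuous_at /= s1 !mulg1 !mulgV s1 invg1 mulg1.
- by apply: thin_cvg => U /sU[].
- by move=> g; apply: comm_cvg => U /sU[_ /(_ g)].
Qed.
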